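(* Let $B$ be a finite Blaschke product satisfying $B(0)=0$ and $B(1)=1$. Write $B(e^{i\theta})=e^{i\varphi(\theta)}$ with $\varphi$ a smooth real-valued phase, and set $q(\theta)=\varphi'(\theta)$. Then $q>0$ and $$\mathcal R(B)=\frac1{2\pi}\int_0^{2\pi}\bigl(1-\cos\varphi(\theta)\bigr)q(\theta)^3\,d\theta>0.$$
   Context: For $F$ analytic in a neighborhood of the closed unit disk $\overline{\mathbb D}$, put $G(z)=zF'(z)$ and define the Schur--Rellich boundary flux $$\mathcal R(F)=\left.\frac1{4\pi}\int_0^{2\pi}\bigl(1-\mathrm{Re}\,F(re^{i\theta})\bigr)\,\partial_r\bigl|G(re^{i\theta})\bigr|^2\,d\theta\right|_{r=1}.$$ *)

(* Defs.v *)
From Stdlib Require Import Reals List.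
From Coquelicot Require Import Coquelicot.

Open Scope R_scope.

Definition cis (t : R) : C := (cos t, sin t).

Definition polar (r t : R) : C := (RtoC r * cis t)%C.

Definition blaschke_factor (a z : C) : C :=
  ((z - a) / (1 - Cconj a * z))%C.

Definition blaschke_eval (c : C) (zeros : list C) (z : C) : C :=
  (c * fold_right (fun a w => blaschke_factor a z * w) (RtoC 1) zeros)%C.

(* The zeros are listed with multiplicity.  The values of [B] at the poles,
   which lie outside the closed unit disk, are left unconstrained. *)
Definition finite_blaschke_product (B : C -> C) : Prop :=
  exists (c : C) (zeros : list C),
    Cmod c = 1 /\
    (forall a, In a zeros -> Cmod a < 1) /\
    (forall z : C,
       (forall a, In a zeros -> (1 - Cconj a * z)%C <> RtoC 0) ->
       B z = blaschke_eval c zeros z).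

Definition smooth (f : R -> R) : Prop :=
  forall (n : nat) (x : R), ex_derive_n f n x.

Definition boundary_phase (B : C -> C) (phi : R -> R) : Prop :=
  smooth phi /\ forall t : R, B (cis t) = cis (phi t).

Definition Gfun (F : C -> C) (z : C) : C := (z * C_derive F z)%C.

Definition flux_at (F : C -> C) (r : R) : R :=
  / (4 * PI) *
  RInt (fun t => (1 - Re (F (polar r t))) *
                 Derive (fun s => Cmod (Gfun F (polar s t)) ^ 2) r)
       0 (2 * PI).

(* Meaningful for [F] analytic in a neighborhood of the closed unit disk;
   [C_derive], [Derive] and [RInt] are total, so no hypothesis is carried. *)
Definition schur_rellich_flux (F : C -> C) : R := flux_at F 1.

(* Main.v *)
Require Import Defs.
From Stdlib Require Import Reals List Lra Lia.
From Coquelicot Require Import Coquelicot.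
Open Scope R_scope.

(** Let F be holomorphic near the unit circle with F(e^{it}) = e^{i phi(t)},
    and put q = phi'.  Differentiating the boundary identity along the circle
    gives i G = i q F there, so that G = q F on the circle, where
    G(z) = z F'(z).  Differentiating once more along the circle yields
    i z G' = (q' + i q^2) F.  The tangential derivative of a holomorphic
    function determines the radial one, hence
    (d/dr) G = z G' = (q^2 - i q') F, and since |F| = 1,
    (d/dr) |G|^2 = 2 Re (conj(G) z G') = 2 q^3.  Integrating against
    1 - Re F = 1 - cos phi is the flux formula; it concerns any function with
    unimodular boundary values ([radial_derivative],
    [flux_of_unimodular_boundary]).

    For a Blaschke factor, e^{it} - a = e^{it} conj(w) with
    w = 1 - conj(a) e^{it} in the right half plane, so an explicit phase is
    t - 2 arctan (Im w / Re w).  Its derivative is the Poisson kernel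
    (1 - |a|^2) / |e^{it} - a|^2, which is positive, and identically 1 when
    a = 0.  A Blaschke product thus has a smooth phase whose derivative is the
    sum of the Poisson kernels of its zeros ([blaschke_eval_phase]), and every
    other differentiable phase has the same derivative
    ([phase_derivative_unique]).  As B(0) = 0 puts 0 among the zeros, q >= 1.

    Positivity of the integral ([flux_integral_pos]): q >= 1 gives
    (1 - cos phi) q^3 >= (1 - cos phi) q = (phi - sin phi)', and over a full
    turn phi - sin phi increases by phi(2 pi) - phi(0) > 0, because sin phi is
    2 pi-periodic. *)

(** * Smooth functions of a real variable *)

(** The derivative is a named witness [f'] rather than [Derive f], so that the
    product and inverse rules are inductions on the order with no Leibniz
    formula. *)
Fixpoint Ck (n : nat) (f : R -> R) : Prop :=
  match n with
  | O => True
  | S m => exists f' : R -> R, (forall x, is_derive f x (f' x)) /\ Ck m f'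
  end.

Lemma Ck_pred n f : Ck (S n) f -> Ck n f.
Proof.
  revert f; induction n as [|n IH]; intros f; [easy|].
  intros [f' [Hf Cf']]; exists f'; split; [easy | now apply IH].
Qed.

Lemma smooth_of_Ck f : (forall n, Ck n f) -> smooth f.
Proof.
  intros H n x; specialize (H n); revert f x H.
  enough (main : forall n f, Ck (S n) f -> forall x, ex_derive (Derive_n f n) x).
  { intros f x H; destruct n; [easy | now apply main]. }
  clear n; intros n; induction n as [|n IH]; intros f [f' [Hf Cf']] x.
  - now exists (f' x).
  - apply (ex_derive_ext (Derive_n f' n)); [|now apply IH].
    intros t. replace (S n) with (n + 1)%nat by lia.
    rewrite <- Derive_n_comp. apply Derive_n_ext; intros y; symmetry.
    now apply is_derive_unique.
Qed.

Lemma Ck_ext n f g : (forall x, f x = g x) -> Ck n f -> Ck n g.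
Proof.
  destruct n as [|n]; [easy|]. intros H [f' [Hf Cf]]; exists f'; split; [|easy].
  intros x; now apply (is_derive_ext f).
Qed.

Lemma Ck_const n c : Ck n (fun _ => c).
Proof.
  revert c; induction n as [|n IH]; intros c; [easy|].
  exists (fun _ => 0); split; [intros x; auto_derive; easy | apply IH].
Qed.

Lemma Ck_plus n f g : Ck n f -> Ck n g -> Ck n (fun x => f x + g x).
Proof.
  revert f g; induction n as [|n IH]; intros f g; [easy|].
  intros [f' [Hf Cf]] [g' [Hg Cg]].
  exists (fun x => f' x + g' x); split; [|now apply IH].
  intros x; now apply (is_derive_plus f g).
Qed.

Lemma Ck_mult n f g : Ck n f -> Ck n g -> Ck n (fun x => f x * g x).
Proof.
  revert f g; induction n as [|n IH]; intros f g; [easy|].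
  intros Hf Hg; assert (Cf0 := Ck_pred _ _ Hf); assert (Cg0 := Ck_pred _ _ Hg).
  destruct Hf as [f' [Hf Cf]], Hg as [g' [Hg Cg]].
  exists (fun x => f' x * g x + f x * g' x); split.
  - intros x; apply (is_derive_mult f g); [easy..|exact Rmult_comm].
  - apply Ck_plus; now apply IH.
Qed.

Lemma Ck_inv n f : (forall x, f x <> 0) -> Ck n f -> Ck n (fun x => / f x).
Proof.
  intros f0; induction n as [|n IH]; [easy|].
  intros Hf; assert (Cf0 := IH (Ck_pred _ _ Hf)); destruct Hf as [f' [Hf Cf]].
  exists (fun x => (- (1) * f' x) * (/ f x * / f x)); split.
  - intros x. replace (_ * _) with (- f' x / f x ^ 2) by (now field).
    now apply is_derive_inv.
  - apply Ck_mult; apply Ck_mult; try easy. apply Ck_const.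
Qed.

Lemma Ck_sin_cos n : Ck n sin /\ Ck n cos.
Proof.
  induction n as [|n [IHs IHc]]; [easy|]; split.
  - exists cos; split; [apply is_derive_sin | easy].
  - exists (fun x => - (1) * sin x); split.
    + intros x; auto_derive; [easy | ring].
    + apply Ck_mult; [apply Ck_const | easy].
Qed.

(** * Complex derivatives *)

(** [C] carries two normed-module structures over itself, which are distinct
    though their norms agree; this fixes the one in which [C_derive] is
    characterised. *)
Definition is_C_derive (F : C -> C) (z l : C) : Prop :=
  @is_derive C_AbsRing C_NormedModule F z l.

Lemma is_C_derive_eps F z l :
  is_C_derive F z l <->
  (forall eps : posreal, locally z (fun w : C =>
     Cmod (F w - F z - l * (w - z)) <= eps * Cmod (w - z))).
Proof.
  unfold is_C_derive, is_derive. split.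
  - intros [_ H] eps. specialize (H z (fun P HP => HP) eps).
    apply locally_C. revert H; apply filter_imp; intros w.
    change (Cmod (F w - F z - (w - z) * l) <= eps * Cmod (w - z) ->
    Cmod (F w - F z - l * (w - z)) <= eps * Cmod (w - z)).
    now rewrite (Cmult_comm l).
  - intros H; split.
    { apply is_linear_scal_l. }
    intros y Hy; apply (is_filter_lim_locally_unique (V := AbsRing_NormedModule C_AbsRing) z y)
      in Hy.
    rewrite <- Hy; intros eps.
    apply -> locally_C; generalize (H eps); apply filter_imp; intros w.
    change (Cmod (F w - F z - l * (w - z)) <= eps * Cmod (w - z) ->
      Cmod (F w - F z - (w - z) * l) <= eps * Cmod (w - z)).
    now rewrite (Cmult_comm l).
Qed.

(** The product, identity and chain rules are stated for the structure that a
    normed ring has over itself; this transfers them. *)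
Lemma is_C_derive_AbsRing F z l :
  is_C_derive F z l <-> is_derive (V := AbsRing_NormedModule C_AbsRing) F z l.
Proof.
  split; intros [_ H]; (split; [apply is_linear_scal_l | exact H]).
Qed.

Lemma is_C_derive_mult F G z l m :
  is_C_derive F z l -> is_C_derive G z m ->
  is_C_derive (fun w => F w * G w)%C z (l * G z + F z * m)%C.
Proof.
  intros HF%is_C_derive_AbsRing HG%is_C_derive_AbsRing; apply is_C_derive_AbsRing.
  apply (is_derive_mult (K := C_AbsRing) F G z l m HF HG).
  exact Cmult_comm.
Qed.

Lemma is_C_derive_const c z : is_C_derive (fun _ => c) z 0%C.
Proof. apply (is_derive_const (K := C_AbsRing) (V := C_NormedModule) c z). Qed.

Lemma is_C_derive_id z : is_C_derive (fun w => w) z 1%C.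
Proof. apply is_C_derive_AbsRing, (is_derive_id (K := C_AbsRing) z). Qed.

Lemma is_C_derive_plus F G z l m :
  is_C_derive F z l -> is_C_derive G z m ->
  is_C_derive (fun w => F w + G w)%C z (l + m)%C.
Proof. apply (is_derive_plus (K := C_AbsRing) (V := C_NormedModule) F G). Qed.

Lemma is_C_derive_affine p q z : is_C_derive (fun w => p + q * w)%C z q.
Proof.
  assert (H := is_C_derive_plus _ _ z _ _ (is_C_derive_const p z)
    (is_C_derive_mult _ _ z _ _ (is_C_derive_const q z) (is_C_derive_id z))).
  cbv beta in H; replace (0 + (0 * z + q * 1))%C with q in H by ring; exact H.
Qed.

Lemma is_C_derive_comp F G z l m :
  is_C_derive F (G z) l -> is_C_derive G z m ->
  is_C_derive (fun w => F (G w)) z (m * l)%C.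
Proof.
  intros HF HG%is_C_derive_AbsRing.
  exact (is_derive_comp (K := C_AbsRing) (V := C_NormedModule) F G z l m HF HG).
Qed.

Lemma is_C_derive_ext_loc F G z l :
  locally z (fun w : C => F w = G w) -> is_C_derive F z l -> is_C_derive G z l.
Proof.
  intros H; apply (is_derive_ext_loc (K := C_AbsRing) (V := C_NormedModule) F G).
  now apply -> locally_C.
Qed.

Lemma is_C_derive_Cinv (z : C) : z <> 0%C -> is_C_derive Cinv z (- / (z * z))%C.
Proof.
  (* 1/w - 1/z + (w-z)/z^2 = (w-z)^2 / (w z^2), where |w| > |z|/2 near z *)
  intros z0; assert (m0 := proj1 (Cmod_gt_0 z) z0); apply is_C_derive_eps; intros eps.
  assert (d0 : 0 < Rmin (Cmod z / 2) (eps * Cmod z ^ 3 / 2)).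
  { destruct eps as [e e0]; cbn. apply Rmin_pos; [lra|].
    assert (0 < Cmod z ^ 3) by now apply pow_lt.
    assert (0 < e * Cmod z ^ 3) by now apply Rmult_lt_0_compat.
    lra. }
  apply locally_C; exists (mkposreal _ d0); intros w Hw.
  change (Cmod (w - z) < Rmin (Cmod z / 2) (eps * Cmod z ^ 3 / 2)) in Hw.
  assert (Hw1 := Rlt_le_trans _ _ _ Hw (Rmin_l _ _)).
  assert (Hw2 := Rlt_le_trans _ _ _ Hw (Rmin_r _ _)).
  assert (mw : Cmod z / 2 < Cmod w).
  { generalize (Cmod_triangle w (- (w - z))). rewrite Cmod_opp.
    replace (w + - (w - z))%C with z by ring. lra. }
  assert (w0 : (w : C) <> RtoC 0). { apply Cmod_gt_0; lra. }
  replace (/ w - / z - - / (z * z) * (w - z))%C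
    with ((w - z) * ((w - z) / (w * (z * z))))%C by (field; easy).
  assert (w * (z * z) <> 0)%C by (repeat apply Cmult_neq_0; easy).
  rewrite Cmod_mult, Cmod_div by easy. rewrite Rmult_comm, !Cmod_mult.
  apply Rmult_le_compat_r; [apply Cmod_ge_0|].
  apply Rle_div_l. 1:{ repeat apply Rmult_lt_0_compat; lra. }
  apply Rle_trans with (1 := Rlt_le _ _ Hw2).
  destruct eps as [e e0]; cbn.
  assert (0 < e * (Cmod z * Cmod z)) by (repeat apply Rmult_lt_0_compat; lra). nra.
Qed.

(** The regularity of [F] at [z] that makes [Gfun F] differentiable at [z]. *)
Definition twice_holomorphic (F : C -> C) (z : C) : Prop :=
  exists F1 : C -> C,
    locally z (fun w : C => is_C_derive F w (F1 w)) /\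
    exists F2, is_C_derive F1 z F2.

Lemma twice_holomorphic_const c z : twice_holomorphic (fun _ => c) z.
Proof.
  exists (fun _ => RtoC 0); split.
  - apply filter_forall; intros w; apply is_C_derive_const.
  - exists (RtoC 0); apply is_C_derive_const.
Qed.

Lemma twice_holomorphic_mult F G z :
  twice_holomorphic F z -> twice_holomorphic G z ->
  twice_holomorphic (fun w => F w * G w)%C z.
Proof.
  intros [F1 [HF [F2 HF1]]] [G1 [HG [G2 HG1]]].
  exists (fun w => F1 w * G w + F w * G1 w)%C; split.
  - generalize (filter_and _ _ HF HG); apply filter_imp.
    intros w [H1 H2]; now apply is_C_derive_mult.
  - apply locally_singleton in HF, HG.
    eexists; apply is_C_derive_plus; apply is_C_derive_mult; eassumption.
Qed.

Lemma twice_holomorphic_ext_loc F G z :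
  locally z (fun w : C => F w = G w) ->
  twice_holomorphic F z -> twice_holomorphic G z.
Proof.
  intros HFG [F1 [HF HF1]]; exists F1; split; [|easy].
  apply locally_locally in HFG. apply (filter_and _ _ HFG) in HF.
  revert HF; apply filter_imp; intros w [H1 H2].
  now apply is_C_derive_ext_loc with F.
Qed.

(** * Chain rule along real curves in the plane *)

Definition is_curve_derive (g : R -> C) (s : R) (d : C) : Prop :=
  is_derive (fun x => fst (g x)) s (fst d) /\
  is_derive (fun x => snd (g x)) s (snd d).

Lemma is_curve_derive_ext g h s d :
  (forall x, g x = h x) -> is_curve_derive g s d -> is_curve_derive h s d.
Proof.
  intros H [H1 H2]; split; [revert H1|revert H2]; apply is_derive_ext;
  intros x; now rewrite H.
Qed.

Lemma is_curve_derive_unique g s d e :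
  is_curve_derive g s d -> is_curve_derive g s e -> d = e.
Proof.
  intros [H1%is_derive_unique H2%is_derive_unique]
         [H3%is_derive_unique H4%is_derive_unique].
  apply injective_projections; congruence.
Qed.

(** A complex derivative is a real differential.  The real-linear functional
    [pr] stands for the real or the imaginary part, treated at once. *)
Lemma filterdiff_of_is_C_derive (pr : C -> R) F z l :
  (forall a b, pr (a + b)%C = pr a + pr b) ->
  (forall (k : R) a, pr (k * a)%C = k * pr a) ->
  (forall a, Rabs (pr a) <= Cmod a) ->
  is_C_derive F z l ->
  filterdiff (fun t : R * R => pr (F (fst t, snd t))) (locally z)
    (fun t : R * R => pr (l * (fst t, snd t))%C).
Proof.
  intros prD prZ pr1 H; split.
  - split.
    + intros [a b] [c d]; cbn. rewrite <- prD; f_equal.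
      unfold Cmult, Cplus; cbn; f_equal; ring.
    + intros k [a b]; cbn. change (pr (l * ((k * a)%R, (k * b)%R))%C = k * pr (l * (a,b))%C).
      rewrite <- prZ. f_equal. unfold Cmult; cbn; f_equal; ring.
    + exists (Cmod l + 1). split. generalize (Cmod_ge_0 l); lra. intros [a b].
      change (Rabs (pr (l * (a, b))%C) <= (Cmod l + 1) * norm ((a,b) : C_R_NormedModule)).
      rewrite <- Cmod_norm. apply Rle_trans with (1 := pr1 _). rewrite Cmod_mult.
      generalize (Cmod_ge_0 (a,b)); nra.
  - intros y Hy; apply (is_filter_lim_locally_unique (V := C_R_NormedModule) z y) in Hy.
    rewrite <- Hy; intros eps. destruct (is_C_derive_eps F z l) as [H1 _].
    generalize (H1 H eps). apply filter_imp. intros [a b] Hw.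
    rewrite <- !surjective_pairing.
    change (Rabs ((pr (F (a,b)) + - pr (F z)) + - pr (l * ((a,b) - z))%C)
      <= eps * norm (((a,b) - z)%C : C_R_NormedModule)).
    rewrite <- Cmod_norm. apply Rle_trans with (2 := Hw).
    eapply Rle_trans. 2: apply pr1.
    right; f_equal. unfold Cminus. rewrite !prD.
    assert (E : forall c, pr (- c)%C = - pr c).
    { intros c. replace (- c)%C with (RtoC (-1) * c)%C; [rewrite prZ; ring|].
      apply injective_projections; cbn; ring. }
    now rewrite !E.
Qed.

Lemma is_curve_derive_comp F g s l d :
  is_C_derive F (g s) l -> is_curve_derive g s d ->
  is_curve_derive (fun x => F (g x)) s (l * d)%C.
Proof.
  intros HF [H1 H2].
  enough (main : forall pr : C -> R,
    (forall a b, pr (a + b)%C = pr a + pr b) ->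
    (forall (k : R) a, pr (k * a)%C = k * pr a) ->
    (forall a, Rabs (pr a) <= Cmod a) ->
    is_derive (fun x => pr (F (g x))) s (pr (l * d)%C)).
  { split; [apply (main fst) | apply (main snd)]; clear.
    1, 4: easy.
    1, 3: intros k [a b]; cbn; ring.
    all: intros a; eapply Rle_trans; [|apply Rmax_Cmod]; first [apply Rmax_l | apply Rmax_r]. }
  intros pr prD prZ pr1.
  apply (is_derive_ext (fun x => pr (F (fst (g x), snd (g x))))).
  { intros x; now rewrite <- surjective_pairing. }
  unfold is_derive in *.
  rewrite (surjective_pairing (g s)) in HF.
  eapply filterdiff_ext_lin.
  - apply (filterdiff_comp'_2 (fun x => fst (g x)) (fun x => snd (g x))
      (fun u v => pr (F (u, v))) s _ _ (fun u v => pr (l * (u, v))%C) H1 H2).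
    now apply (filterdiff_of_is_C_derive pr F).
  - intros y; cbn. change (pr (l * ((y * fst d)%R, (y * snd d)%R))%C = y * pr (l * d)%C).
    rewrite <- prZ; f_equal. destruct d; unfold Cmult; cbn; f_equal; ring.
Qed.

Lemma is_curve_derive_cis (phi : R -> R) s q :
  is_derive phi s q ->
  is_curve_derive (fun t => cis (phi t)) s (Ci * q * cis (phi s))%C.
Proof.
  intros H; split; cbn.
  - evar_last; [apply (is_derive_comp cos phi); [apply is_derive_cos | exact H]|].
    cbn; unfold scal; cbn; unfold mult; cbn; ring.
  - evar_last; [apply (is_derive_comp sin phi); [apply is_derive_sin | exact H]|].
    cbn; unfold scal; cbn; unfold mult; cbn; ring.
Qed.

Lemma Ci_cancel (a b : C) : (Ci * a = Ci * b)%C -> a = b.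
Proof.
  intros [= H1 H2]; apply injective_projections; lra.
Qed.

(** * The flux of a function with unimodular boundary values *)

Lemma cis_neq_0 t : cis t <> RtoC 0.
Proof. intros [= H1 H2]. generalize (sin2_cos2 t). unfold Rsqr. rewrite H1, H2. lra. Qed.

Lemma polar_1 t : polar 1 t = cis t.
Proof. apply Cmult_1_l. Qed.

Lemma Gfun_twice_holomorphic F z :
  twice_holomorphic F z -> exists G1, is_C_derive (Gfun F) z G1.
Proof.
  intros [F1 [H1 [F2 H2]]].
  exists (1 * F1 z + z * F2)%C.
  apply is_C_derive_ext_loc with (fun w => w * F1 w)%C.
  - revert H1; apply filter_imp; intros w Hw. unfold Gfun. f_equal. symmetry.
    now apply is_C_derive_unique.
  - apply is_C_derive_mult; [apply is_C_derive_id | exact H2].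
Qed.

(** Both sides of F(e^{iu}) = e^{i phi(u)} are differentiated in u. *)
Lemma Gfun_on_circle F phi t :
  (forall u, twice_holomorphic F (cis u)) -> (forall u, ex_derive phi u) ->
  (forall u, F (cis u) = cis (phi u)) ->
  Gfun F (cis t) = (RtoC (Derive phi t) * cis (phi t))%C.
Proof.
  intros HF Hphi Hb.
  destruct (HF t) as [F1 [H1%locally_singleton _]].
  assert (Hid := is_curve_derive_cis (fun x => x) t 1 (is_derive_id t)).
  assert (E1 := is_curve_derive_comp F cis t _ _ H1 Hid).
  assert (E2 := is_curve_derive_cis phi t _ (Derive_correct _ _ (Hphi t))).
  apply (is_curve_derive_ext _ _ _ _ Hb) in E1.
  assert (E := is_curve_derive_unique _ _ _ _ E1 E2).
  unfold Gfun; rewrite (is_C_derive_unique _ _ _ H1).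
  apply Ci_cancel.
  replace (Ci * (cis t * F1 (cis t)))%C with (F1 (cis t) * (Ci * 1 * cis t))%C by ring.
  rewrite E; ring.
Qed.

(** The derivative of G along the circle is computed from G = q F; rotating it
    by -i gives the radial one, and Re (conj(G) dG/dr) = q^3. *)
Lemma radial_derivative F phi t :
  (forall u, twice_holomorphic F (cis u)) -> boundary_phase F phi ->
  Derive (fun s => Cmod (Gfun F (polar s t)) ^ 2) 1 = 2 * Derive phi t ^ 3.
Proof.
  intros HF [Hs Hb].
  assert (HG := fun u => Gfun_on_circle F phi u HF (Hs 1%nat) Hb).
  destruct (Gfun_twice_holomorphic F (cis t) (HF t)) as [G1 H1].
  assert (Hid := is_curve_derive_cis (fun x => x) t 1 (is_derive_id t)).
  set (q := Derive phi) in *. set (q' := Derive q t).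
  assert (Hq : is_derive q t q') by apply Derive_correct, (Hs 2%nat t).
  assert (Hphi : is_derive phi t (q t)) by apply Derive_correct, (Hs 1%nat t).
  assert (E1 := is_curve_derive_comp (Gfun F) cis t _ _ H1 Hid).
  apply (is_curve_derive_ext _ _ _ _ HG) in E1.
  assert (E2 : is_curve_derive (fun x => q x * cis (phi x))%C t
     ((q' + Ci * q t ^ 2) * cis (phi t))%C).
  { destruct (is_curve_derive_cis phi t _ Hphi) as [C1 C2]. split.
    - apply (is_derive_ext (fun x => q x * fst (cis (phi x)))); [intros x; cbn; ring|].
      evar_last; [apply (is_derive_mult q _ t _ _ Hq C1 Rmult_comm)|].
      cbn; unfold plus, mult; cbn; ring.
    - apply (is_derive_ext (fun x => q x * snd (cis (phi x)))); [intros x; cbn; ring|].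
      evar_last; [apply (is_derive_mult q _ t _ _ Hq C2 Rmult_comm)|].
      cbn; unfold plus, mult; cbn; ring. }
  assert (E := is_curve_derive_unique _ _ _ _ E1 E2).
  (* the radial derivative is the tangential one divided by i *)
  assert (D : (G1 * cis t)%C = ((q t ^ 2 - Ci * q') * cis (phi t))%C).
  { apply Ci_cancel.
    replace (Ci * (G1 * cis t))%C with (G1 * (Ci * 1 * cis t))%C by ring.
    rewrite E; apply injective_projections; cbn; ring. }
  assert (P : is_curve_derive (fun s => polar s t) 1 (cis t)).
  { split; cbn; auto_derive; try easy; ring. }
  rewrite <- polar_1 in H1.
  destruct (is_curve_derive_comp (Gfun F) _ 1 _ _ H1 P) as [R1 R2]. rewrite D in R1, R2.
  apply is_derive_unique.
  apply (is_derive_ext (fun s =>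
    fst (Gfun F (polar s t)) * fst (Gfun F (polar s t)) +
    snd (Gfun F (polar s t)) * snd (Gfun F (polar s t)))).
  { intros s. rewrite Cmod2_alt. unfold Re, Im.
    set (a := fst _); set (b := snd _); change (a * a + b * b = a ^ 2 + b ^ 2). ring. }
  evar_last.
  { apply (is_derive_plus (V := R_NormedModule)).
    apply (is_derive_mult _ _ _ _ _ R1 R1 Rmult_comm).
    apply (is_derive_mult _ _ _ _ _ R2 R2 Rmult_comm). }
  rewrite polar_1, HG. cbn. unfold plus, mult; cbn.
  generalize (sin2_cos2 (phi t)). unfold Rsqr.
  set (S := sin (phi t)); set (K := cos (phi t)); intros H.
  transitivity (2 * q t * q t * q t * (S * S + K * K)). ring. rewrite H; ring.
Qed.

Lemma smooth_flux_integrand_continuous phi t :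
  smooth phi -> continuous (fun t => (1 - cos (phi t)) * Derive phi t ^ 3) t.
Proof.
  intros Hs; apply (ex_derive_continuous (V := R_NormedModule)).
  auto_derive; repeat split; [apply (Hs 1%nat) | apply (Hs 2%nat)].
Qed.

Lemma flux_of_unimodular_boundary F phi :
  (forall t, twice_holomorphic F (cis t)) -> boundary_phase F phi ->
  schur_rellich_flux F =
    / (2 * PI) * RInt (fun t => (1 - cos (phi t)) * Derive phi t ^ 3) 0 (2 * PI).
Proof.
  intros HF Hb. unfold schur_rellich_flux, flux_at.
  set (w := fun t => (1 - cos (phi t)) * Derive phi t ^ 3).
  assert (ex : ex_RInt w 0 (2 * PI)).
  { apply (ex_RInt_continuous (V := R_CompleteNormedModule)); intros t _.
    apply smooth_flux_integrand_continuous, (proj1 Hb). }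
  assert (E := RInt_scal (V := R_CompleteNormedModule) w 0 (2 * PI) 2 ex).
  change (RInt (fun t => 2 * w t) 0 (2 * PI) = 2 * RInt w 0 (2 * PI)) in E.
  rewrite (RInt_ext _ (fun t => 2 * w t)).
  - rewrite E; generalize PI_neq0; intros H; now field.
  - intros t _. rewrite radial_derivative with (phi := phi) by easy.
    rewrite polar_1, (proj2 Hb). unfold w; cbn; ring.
Qed.

(** * Phase of a Blaschke product *)

Definition poisson (a : C) (t : R) : R := (1 - Cmod a ^ 2) / Cmod (cis t - a) ^ 2.

Definition circle_speed (zeros : list C) (t : R) : R :=
  fold_right (fun a s => poisson a t + s) 0 zeros.

Lemma Cmod_cis t : Cmod (cis t) = 1.
Proof.
  unfold Cmod, cis; cbn -[pow]. replace (_ + _) with 1; [apply sqrt_1|].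
  generalize (sin2_cos2 t); unfold Rsqr; intros H; rewrite <- H; ring.
Qed.

Lemma Cmod_cis_minus_pos a t : Cmod a < 1 -> 0 < Cmod (cis t - a).
Proof.
  intros Ha; generalize (Cmod_triangle (cis t - a) a).
  replace (cis t - a + a)%C with (cis t) by ring. rewrite Cmod_cis; lra.
Qed.

Lemma poisson_pos a t : Cmod a < 1 -> 0 < poisson a t.
Proof.
  intros Ha; apply Rdiv_lt_0_compat.
  - generalize (Cmod_ge_0 a); nra.
  - now apply pow_lt, Cmod_cis_minus_pos.
Qed.

Lemma poisson_0 t : poisson 0 t = 1.
Proof.
  unfold poisson. rewrite Cmod_0. replace (cis t - 0)%C with (cis t) by ring.
  rewrite Cmod_cis; field.
Qed.

Lemma circle_speed_ge0 zeros t :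
  (forall a, In a zeros -> Cmod a < 1) -> 0 <= circle_speed zeros t.
Proof.
  induction zeros as [|a l IH]; cbn; intros H; [lra|].
  generalize (poisson_pos a t (H a (or_introl eq_refl))) (IH (fun b h => H b (or_intror h))).
  unfold circle_speed; lra.
Qed.

(** The Poisson kernel of the zero at the origin is identically 1. *)
Lemma circle_speed_ge1 zeros t :
  (forall a, In a zeros -> Cmod a < 1) -> In (RtoC 0) zeros ->
  1 <= circle_speed zeros t.
Proof.
  induction zeros as [|a l IH]; cbn; intros H H0; [easy|].
  assert (Hl : forall b, In b l -> Cmod b < 1) by auto.
  destruct H0 as [-> | H0].
  - rewrite poisson_0. generalize (circle_speed_ge0 l t Hl); unfold circle_speed; lra.
  - generalize (poisson_pos a t (H a (or_introl eq_refl))) (IH Hl H0).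
    unfold circle_speed; lra.
Qed.

Lemma Ck_circle_speed n zeros :
  (forall a, In a zeros -> Cmod a < 1) -> Ck n (circle_speed zeros).
Proof.
  induction zeros as [|a l IH]; intros H; [apply (Ck_const n 0)|].
  apply (Ck_plus n (poisson a) (circle_speed l)); [|apply IH; intros b h; apply H; now right].
  apply (Ck_mult n (fun _ => 1 - Cmod a ^ 2)); [apply Ck_const|].
  apply (Ck_inv n (fun t => Cmod (cis t - a) ^ 2)).
  - intros t; apply pow_nonzero, Rgt_not_eq, Cmod_cis_minus_pos, H; now left.
  - assert (L : forall f c, Ck n f -> Ck n (fun t => (f t - c) * (f t - c))).
    { intros f c Hf; apply Ck_mult; (apply Ck_plus; [easy | apply Ck_const]). }
    destruct (Ck_sin_cos n) as [Hs Hc].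
    apply (Ck_ext n (fun t => (cos t - fst a) * (cos t - fst a) +
      (sin t - snd a) * (sin t - snd a))).
    + intros t; rewrite Cmod2_alt; cbn; ring.
    + apply Ck_plus; apply L; easy.
Qed.

Lemma cis_plus s t : cis (s + t) = (cis s * cis t)%C.
Proof.
  unfold cis, Cmult; cbn; rewrite cos_plus, sin_plus; f_equal; ring.
Qed.

Lemma cis_surj c : Cmod c = 1 -> exists t, c = cis t.
Proof.
  intros H; assert (E : fst c ^ 2 + snd c ^ 2 = 1).
  { change (Re c ^ 2 + Im c ^ 2 = 1); rewrite <- Cmod2_alt, H; ring. }
  destruct c as [x y]; cbn [fst snd] in E.
  assert (hx : -1 <= x <= 1) by nra.
  assert (S : sin (acos x) = Rabs y).
  { rewrite sin_acos by easy. rewrite <- sqrt_Rsqr_abs; f_equal; unfold Rsqr; lra. }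
  destruct (Rle_lt_dec 0 y) as [hy | hy].
  - exists (acos x); unfold cis. now rewrite cos_acos, S, Rabs_right by lra.
  - exists (- acos x); unfold cis.
    rewrite cos_neg, sin_neg, cos_acos, S, Rabs_left by lra. f_equal; lra.
Qed.

(** For w = u + iv in the right half plane, w e^{-2i arg w} = conj(w), and
    arg w is a single arctangent. *)
Lemma cis_double_atan (u v : R) : 0 < u ->
  ((u, v) * cis (- 2 * atan (v / u)))%C = (u, - v).
Proof.
  intros u0. set (b := atan (v / u)).
  assert (T : sin b = v / u * cos b).
  { assert (cos b <> 0)
      by (destruct (atan_bound (v / u)); apply Rgt_not_eq, cos_gt_0; unfold b; lra).
    rewrite <- (tan_atan (v / u)). fold b. unfold tan. now field. }
  assert (T' : u * sin b = v * cos b) by (rewrite T; field; lra).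
  generalize (sin2_cos2 b); unfold Rsqr; intros E.
  replace (- 2 * b) with (- (2 * b)) by ring.
  unfold cis, Cmult; cbn; rewrite cos_neg, sin_neg, cos_2a, sin_2a.
  f_equal.
  - transitivity (u * (sin b * sin b + cos b * cos b) +
      2 * sin b * (v * cos b - u * sin b)); [ring|].
    rewrite E, T'; ring.
  - transitivity (- v * (sin b * sin b + cos b * cos b) +
      2 * cos b * (v * cos b - u * sin b)); [ring|].
    rewrite E, T'; ring.
Qed.

Lemma blaschke_denominator_neq0 a w : Cmod a * Cmod w < 1 -> (1 - Cconj a * w)%C <> RtoC 0.
Proof.
  intros H E. rewrite <- (Cmod_conj a), <- Cmod_mult in H.
  replace (Cconj a * w)%C with (1 - (1 - Cconj a * w))%C in H by ring.
  rewrite E in H. replace (1 - 0)%C with (RtoC 1) in H by ring. rewrite Cmod_1 in H; lra.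
Qed.

(** With w = 1 - conj(a) e^{it} = u + iv, the numerator is e^{it} conj(w), so
    the factor is e^{it} conj(w) / w and u > 0 because |a| < 1. *)
Lemma blaschke_factor_phase a : Cmod a < 1 ->
  exists psi, (forall t, is_derive psi t (poisson a t)) /\
    forall t, blaschke_factor a (cis t) = cis (psi t).
Proof.
  intros Ha. destruct a as [x y] eqn:Ea. rewrite <- Ea in *.
  set (u := fun t => 1 - x * cos t - y * sin t).
  set (v := fun t => y * cos t - x * sin t).
  assert (Dw : forall t, (1 - Cconj a * cis t)%C = (u t, v t)).
  { intros t; rewrite Ea; unfold u, v; apply injective_projections; cbn; ring. }
  assert (Hm : Cmod a ^ 2 = x ^ 2 + y ^ 2) by (rewrite Ea; apply Cmod2_alt).
  assert (u0 : forall t, 0 < u t).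
  { intros t. generalize (re_le_Cmod (Cconj a * cis t)).
    rewrite Cmod_mult, Cmod_conj, Cmod_cis. intros H%Rabs_le_between.
    replace (Re (Cconj a * cis t)) with (x * cos t + y * sin t) in H
      by (rewrite Ea; cbn; ring). unfold u; lra. }
  exists (fun t => t + - 2 * atan (v t / u t)); split; intros t.
  - assert (ut := u0 t). generalize (sin2_cos2 t); unfold Rsqr; intros E.
    assert (N : u t ^ 2 + v t ^ 2 = Cmod (cis t - a) ^ 2).
    { rewrite Cmod2_alt, Ea; unfold u, v; cbn.
      transitivity (1 - 2 * (x * cos t + y * sin t)
        + (x * x + y * y) * (sin t * sin t + cos t * cos t)); [ring|].
      rewrite E; transitivity (sin t * sin t + cos t * cos t
        - 2 * (x * cos t + y * sin t) + (x * x + y * y)); [rewrite E|]; ring. }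
    assert (V : 2 * u t - (u t ^ 2 + v t ^ 2) = 1 - Cmod a ^ 2).
    { rewrite Hm; unfold u, v.
      transitivity (1 - (x * x + y * y) * (sin t * sin t + cos t * cos t)); [ring|].
      rewrite E; ring. }
    assert (N0 : u t ^ 2 + v t ^ 2 <> 0) by nra.
    unfold poisson; rewrite <- N, <- V.
    assert (Du : is_derive u t (- v t)) by (unfold u, v; auto_derive; [easy | ring]).
    assert (Dv : is_derive v t (u t - 1)) by (unfold u, v; auto_derive; [easy | ring]).
    clearbody u v. auto_derive.
    + repeat split; [now exists (u t - 1) | now exists (- v t) | lra].
    + replace (Derive (fun s : R => u s) t) with (- v t)
        by (symmetry; now apply is_derive_unique).
      replace (Derive (fun s : R => v s) t) with (u t - 1)
        by (symmetry; now apply is_derive_unique).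
      field; split; [exact N0 | lra].
  - unfold blaschke_factor.
    rewrite cis_plus.
    assert (n0 : (1 - Cconj a * cis t)%C <> RtoC 0)
      by (apply blaschke_denominator_neq0; rewrite Cmod_cis; lra).
    assert (M := cis_double_atan (u t) (v t) (u0 t)).
    assert (Nm : (cis t - a)%C = (cis t * (u t, (- v t)%R))%C).
    { generalize (sin2_cos2 t); unfold Rsqr; intros E.
      rewrite Ea; unfold u, v; apply injective_projections; cbn.
      - transitivity (cos t - x * (sin t * sin t + cos t * cos t)); [rewrite E|]; ring.
      - transitivity (sin t - y * (sin t * sin t + cos t * cos t)); [rewrite E|]; ring. }
    rewrite Nm, <- M, <- Dw. now field.
Qed.

Lemma blaschke_eval_phase c zeros :
  Cmod c = 1 -> (forall a, In a zeros -> Cmod a < 1) ->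
  exists phi, (forall t, is_derive phi t (circle_speed zeros t)) /\
    forall t, blaschke_eval c zeros (cis t) = cis (phi t).
Proof.
  intros [s ->]%cis_surj; unfold blaschke_eval; induction zeros as [|a l IH]; intros H.
  - exists (fun _ => s); split; intros t; cbn; [auto_derive; easy | ring].
  - destruct IH as [phi [D E]]; [intros b h; apply H; now right|].
    destruct (blaschke_factor_phase a) as [psi [D' E']]; [apply H; now left|].
    exists (fun t => psi t + phi t); split; intros t.
    + now apply (is_derive_plus psi phi).
    + cbn [fold_right]. rewrite cis_plus, <- E, <- E'; ring.
Qed.

(** * Regularity of a Blaschke product near the circle *)

Lemma blaschke_denominator_neq0_near a t : Cmod a < 1 ->
  locally (cis t) (fun w : C => (1 - Cconj a * w)%C <> RtoC 0).
Proof.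
  (* |w| < 2 - |a| on the disk of radius 1 - |a|, and |a| (2 - |a|) < 1 *)
  intros Ha. assert (d0 : 0 < 1 - Cmod a) by lra.
  apply locally_C; exists (mkposreal _ d0); intros w Hw.
  change (Cmod (w - cis t) < 1 - Cmod a) in Hw.
  apply blaschke_denominator_neq0.
  assert (S : forall p q : C, (p - q + q)%C = p) by (intros; ring).
  generalize (Cmod_triangle (w - cis t) (cis t)); rewrite S, Cmod_cis.
  generalize (Cmod_ge_0 a); nra.
Qed.

Lemma blaschke_factor_twice_holomorphic a t : Cmod a < 1 ->
  twice_holomorphic (blaschke_factor a) (cis t).
Proof.
  intros Ha.
  assert (Dinv : forall w, (1 - Cconj a * w)%C <> RtoC 0 ->
    is_C_derive (fun z => / (1 - Cconj a * z))%C w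
      (Cconj a * (/ (1 - Cconj a * w) * / (1 - Cconj a * w)))%C).
  { intros w n0.
    assert (L : is_C_derive (fun z => 1 - Cconj a * z)%C w (- Cconj a)%C).
    { apply is_C_derive_ext_loc with (fun z => 1 + - Cconj a * z)%C;
        [|apply is_C_derive_affine].
      apply filter_forall; intros z; ring. }
    replace (Cconj a * _)%C with (- Cconj a * - / ((1 - Cconj a * w) * (1 - Cconj a * w)))%C
      by (now field).
    apply (is_C_derive_comp Cinv _ w _ _ (is_C_derive_Cinv _ n0) L). }
  apply twice_holomorphic_mult with (F := fun w => (w - a)%C).
  - exists (fun _ => RtoC 1); split; [|exists (RtoC 0); apply is_C_derive_const].
    apply filter_forall; intros w.
    apply is_C_derive_ext_loc with (fun z => - a + 1 * z)%C; [|apply is_C_derive_affine].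
    apply filter_forall; intros z; ring.
  - assert (N := blaschke_denominator_neq0_near a t Ha).
    exists (fun w => Cconj a * (/ (1 - Cconj a * w) * / (1 - Cconj a * w)))%C; split.
    + revert N; apply filter_imp; exact Dinv.
    + apply locally_singleton, Dinv in N. eexists.
      apply is_C_derive_mult; [apply is_C_derive_const|].
      apply is_C_derive_mult; exact N.
Qed.

Lemma blaschke_eval_twice_holomorphic c zeros t :
  (forall a, In a zeros -> Cmod a < 1) ->
  twice_holomorphic (blaschke_eval c zeros) (cis t).
Proof.
  intros H; set (P := fun l z => fold_right (fun a w => blaschke_factor a z * w)%C (RtoC 1) l).
  apply (twice_holomorphic_mult (fun _ => c) (P zeros)); [apply twice_holomorphic_const|].
  induction zeros as [|a l IH]; [apply (twice_holomorphic_const (RtoC 1))|].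
  apply (twice_holomorphic_mult (blaschke_factor a) (P l)).
  - apply blaschke_factor_twice_holomorphic, H; now left.
  - apply IH; intros b h; apply H; now right.
Qed.

Lemma blaschke_poles_off_circle zeros t :
  (forall a, In a zeros -> Cmod a < 1) ->
  locally (cis t) (fun w : C => forall a, In a zeros -> (1 - Cconj a * w)%C <> RtoC 0).
Proof.
  induction zeros as [|a l IH]; intros H; [now apply filter_forall|].
  generalize (filter_and _ _ (blaschke_denominator_neq0_near a t (H a (or_introl eq_refl)))
    (IH (fun b h => H b (or_intror h)))).
  apply filter_imp; intros w [Hw1 Hw2] b [<- | h]; [easy | now apply Hw2].
Qed.

Lemma blaschke_eval_0_In c zeros :
  Cmod c = 1 -> blaschke_eval c zeros 0 = RtoC 0 -> In (RtoC 0) zeros.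
Proof.
  intros Hc; unfold blaschke_eval.
  assert (c0 : c <> RtoC 0) by (apply Cmod_gt_0; lra).
  set (P := fold_right (fun a w => blaschke_factor a 0 * w)%C (RtoC 1) zeros); intros E.
  assert (P0 : P = RtoC 0).
  { destruct (Ceq_dec P (RtoC 0)) as [e | e]; [easy | now destruct (Cmult_neq_0 _ _ c0 e)]. }
  unfold P in P0; clear P E.
  induction zeros as [|a l IH]; cbn in P0 |- *; [now injection P0; lra|].
  destruct (Ceq_dec a (RtoC 0)) as [e | e]; [now left|right; apply IH].
  match goal with |- ?p = _ => destruct (Ceq_dec p (RtoC 0)) as [h | h]; [easy|] end.
  destruct (fun k => Cmult_neq_0 _ _ k h P0).
  unfold blaschke_factor. replace (1 - Cconj a * 0)%C with (RtoC 1) by ring.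
  intros k; apply e. replace a with (- ((0 - a) / 1))%C by field. rewrite k; ring.
Qed.

(** * Uniqueness of the phase speed and positivity of the flux *)

(** The derivative i q e^{i phi} of e^{i phi} determines q. *)
Lemma phase_derivative_unique phi psi t q :
  (forall u, cis (phi u) = cis (psi u)) ->
  ex_derive phi t -> is_derive psi t q -> Derive phi t = q.
Proof.
  intros H D1%Derive_correct D2.
  apply is_curve_derive_cis, (is_curve_derive_ext _ _ _ _ H) in D1.
  apply is_curve_derive_cis in D2.
  assert (E := is_curve_derive_unique _ _ _ _ D1 D2).
  rewrite H in E.
  apply (f_equal (fun w => w / (Ci * cis (psi t)))%C) in E.
  apply RtoC_inj.
  assert (n0 := cis_neq_0 (psi t)).
  assert (i0 : Ci <> RtoC 0) by (intros [= h]; lra).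
  transitivity (Ci * Derive phi t * cis (psi t) / (Ci * cis (psi t)))%C; [now field|].
  rewrite E; now field.
Qed.

(** Since q^3 >= q, the integrand dominates the derivative of phi - sin phi,
    whose increment over a period is that of phi. *)
Lemma flux_integral_pos phi :
  smooth phi -> (forall t, 1 <= Derive phi t) ->
  cis (phi 0) = cis (phi (2 * PI)) ->
  0 < RInt (fun t => (1 - cos (phi t)) * Derive phi t ^ 3) 0 (2 * PI).
Proof.
  intros Hs q1 Hper. assert (pi0 := PI_RGT_0).
  set (q := Derive phi) in *.
  assert (Dphi : forall t, is_derive phi t (q t))
    by (intros t; apply Derive_correct, (Hs 1%nat)).
  assert (I : is_RInt (fun t => (1 - cos (phi t)) * q t) 0 (2 * PI)
     (minus (phi (2 * PI) - sin (phi (2 * PI))) (phi 0 - sin (phi 0)))).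
  { apply (is_RInt_derive (V := R_CompleteNormedModule) (fun t => phi t - sin (phi t))).
    - intros t _; auto_derive; [repeat split; now exists (q t)|].
      change (Derive (fun x => phi x) t) with (q t); ring.
    - intros t _. apply (ex_derive_continuous (V := R_NormedModule)).
      auto_derive; repeat split; [now exists (q t) | apply (Hs 2%nat)]. }
  assert (J := RInt_correct (V := R_CompleteNormedModule) _ 0 (2 * PI)
    (ex_RInt_continuous (V := R_CompleteNormedModule) _ 0 (2 * PI)
      (fun t _ => smooth_flux_integrand_continuous phi t Hs))).
  fold q in J.
  assert (L := is_RInt_le _ _ 0 (2 * PI) _ _ ltac:(lra) I J).
  injection Hper; intros Hsin _.
  destruct (MVT_gen phi 0 (2 * PI) q) as [xi [_ Hxi]].
  { intros t _; apply Dphi. }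
  { intros t _; apply continuity_pt_filterlim, (ex_derive_continuous (V := R_NormedModule)).
    now exists (q t). }
  eapply Rlt_le_trans; [|apply L].
  - change (0 < phi (2 * PI) - sin (phi (2 * PI)) - (phi 0 - sin (phi 0))).
    rewrite Hsin. generalize (q1 xi); nra.
  - intros t _; apply Rmult_le_compat_l; [generalize (COS_bound (phi t)); lra|].
    generalize (q1 t); fold q; nra.
Qed.

Theorem theorem3p14 (B : C -> C)
  (hB : finite_blaschke_product B)
  (hB0 : B (RtoC 0) = RtoC 0)
  (hB1 : B (RtoC 1) = RtoC 1) :
  (exists phi : R -> R, boundary_phase B phi) /\
  (forall phi : R -> R, boundary_phase B phi ->
     let q := Derive phi in
     (forall t : R, 0 < q t) /\
     schur_rellich_flux B =
       / (2 * PI) * RInt (fun t => (1 - cos (phi t)) * q t ^ 3) 0 (2 * PI) /\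
     / (2 * PI) * RInt (fun t => (1 - cos (phi t)) * q t ^ 3) 0 (2 * PI) > 0).
Proof.
  destruct hB as [c [zeros [Hc [Hz HB]]]].
  assert (Z0 : In (RtoC 0) zeros).
  { apply (blaschke_eval_0_In c); [easy|]. rewrite <- HB; [easy|].
    intros a _; apply blaschke_denominator_neq0; rewrite Cmod_0; lra. }
  assert (HBnear : forall t, locally (cis t) (fun w : C => blaschke_eval c zeros w = B w)).
  { intros t; generalize (blaschke_poles_off_circle zeros t Hz); apply filter_imp.
    intros w Hw; symmetry; now apply HB. }
  destruct (blaschke_eval_phase c zeros Hc Hz) as [psi [Dpsi Epsi]].
  assert (HBpsi : forall t, B (cis t) = cis (psi t)).
  { intros t; rewrite <- Epsi; symmetry; exact (locally_singleton _ _ (HBnear t)). }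
  split.
  - exists psi; split; [|exact HBpsi].
    apply smooth_of_Ck; intros n; apply Ck_pred.
    exists (circle_speed zeros); split; [exact Dpsi | now apply Ck_circle_speed].
  - intros phi Hphi q. destruct (Hphi) as [Hs Hb].
    assert (Hq : forall t, q t = circle_speed zeros t).
    { intros t; apply phase_derivative_unique with psi; [|apply (Hs 1%nat)|apply Dpsi].
      intros u; now rewrite <- Hb, HBpsi. }
    assert (q1 : forall t, 1 <= q t) by (intros t; rewrite Hq; now apply circle_speed_ge1).
    split; [|split].
    + intros t; generalize (q1 t); lra.
    + apply flux_of_unimodular_boundary; [|easy].
      intros t; apply twice_holomorphic_ext_loc with (1 := HBnear t).
      now apply blaschke_eval_twice_holomorphic.
    + generalize PI_RGT_0; intros Hpi; apply Rmult_lt_0_compat.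
      * apply Rinv_0_lt_compat; lra.
      * apply flux_integral_pos; [easy | exact q1 |].
        rewrite <- !Hb; f_equal. unfold cis; now rewrite cos_0, sin_0, cos_2PI, sin_2PI.
Qed.
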